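(* Let $n\ge 1$ and fix finite nonempty supports $A_1,\ldots,A_n\subseteq\mathbb{R}^n$ and $\varepsilon>0$. For $m\in\mathbb{Z}_{>0}$ consider the random system $$F_{mA_1,c_1}(w)=0,\ \ldots,\ F_{mA_n,c_n}(w)=0$$ for the stretched supports $mA_i=\{ma\mid a\in A_i\}$, where all coefficients $c_i(a)$ ($i=1,\ldots,n$, $a\in mA_i$) are independent standard Gaussian random variables. Then the probability that this system has a zero $w\in\mathbb{R}^n$ with $\|w\|>\varepsilon$ tends to $0$ as $m\to\infty$.
   Context: For a finite nonempty set $B\subseteq\mathbb{R}^n$ and a function $c\colon B\to\mathbb{R}$, $F_{B,c}\colon\mathbb{R}^n\to\mathbb{R}$ is defined by $F_{B,c}(w)=\sum_{b\in B}c(b)e^{\langle b,w\rangle}$. $\|\cdot\|$ is the Euclidean norm. *)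

(* Defs.v *)
From HB Require Import structures.
From mathcomp Require Import all_boot all_order all_algebra finmap.
From mathcomp Require Import all_classical all_reals all_analysis.

Set Implicit Arguments.
Unset Strict Implicit.
Unset Printing Implicit Defensive.

Import Order.TTheory GRing.Theory Num.Theory.
Import numFieldNormedType.Exports.

Local Open Scope classical_set_scope.
Local Open Scope ring_scope.

Definition dot (R : realType) (n : nat) (u v : 'rV[R]_n) : R :=
  \sum_(k < n) u 0 k * v 0 k.

(* The library norm `|v| on 'rV[R]_n is the sup norm, hence this one. *)
Definition euclidean_norm (R : realType) (n : nat) (v : 'rV[R]_n) : R :=
  Num.sqrt (dot v v).

Definition exp_sum (R : realType) (n : nat) (B : {fset 'rV[R]_n})
    (c : B -> R) (w : 'rV[R]_n) : R :=
  \sum_(b : B) c b * expR (dot (val b) w).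

Definition stretch (R : realType) (n : nat) (m : nat) (A : {fset 'rV[R]_n}) :
    {fset 'rV[R]_n} :=
  [fset m%:R *: a | a in A]%fset.

(* The law is compared on measurable sets only: outside of them the values of
   [P] and [normal_prob] carry no information. *)
Definition standard_gaussian (R : realType) (d : measure_display)
    (T : measurableType d) (P : probability T R) (X : {RV P >-> R}) : Prop :=
  forall B : set R, measurable B -> P (X @^-1` B) = normal_prob 0 1 B.

Definition mutually_independent (R : realType) (d : measure_display)
    (T : measurableType d) (P : probability T R) (I : finType)
    (X : I -> {RV P >-> R}) : Prop :=
  forall (J : {set I}) (B : I -> set R),
    (forall j, j \in J -> measurable (B j)) ->
    P (\bigcap_(j in [set` J]) (X j @^-1` B j)) =
    (\prod_(j in J) P (X j @^-1` B j))%E.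

(* Coefficients of the n polynomials form one family, indexed by the pairs
   (i, b) with b in B i. *)
Definition iid_standard_gaussian (R : realType) (n : nat)
    (B : 'I_n -> {fset 'rV[R]_n}) (d : measure_display)
    (T : measurableType d) (P : probability T R)
    (c : forall i : 'I_n, B i -> {RV P >-> R}) : Prop :=
  (forall (i : 'I_n) (b : B i), standard_gaussian (c i b)) /\
  mutually_independent (fun j : {i : 'I_n & B i} => c (tag j) (tagged j)).

(* Main.v *)
Require Import Defs.
From HB Require Import structures.
From mathcomp Require Import all_boot all_order all_algebra finmap.
From mathcomp Require Import all_classical all_reals all_analysis.
From mathcomp Require Import measurable_realfun ring lra.
Set Implicit Arguments.
Unset Strict Implicit.
Unset Printing Implicit Defensive.

Import Order.TTheory GRing.Theory Num.Theory.
Import numFieldNormedType.Exports.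

Local Open Scope classical_set_scope.
Local Open Scope ring_scope.

(* Replacing the zero [w] by [u = m w] turns the system with supports [m A_i]
   into the one with supports [A_i], so it suffices to bound, uniformly over all
   Gaussian systems with supports [A_i], the probability of a zero [u] of norm
   greater than [r], and to let [r] grow.  Divide the i-th equation by its
   largest exponential, the pivot.  Fix a natural number [l] and put
   [delta = exp(-l)].  The exponentials smaller than [delta] are negligible; the
   others have exponents in [[-l, 0]], given by linear forms in [u].  If these
   forms have rank [n], then the norm of [u] is at most [C l].  So, beyond
   radius [C l], they have rank at most [n - 1], and up to an error [C delta] the
   vector of exponentials is one of only [C ((l + 1) / delta)^(n - 1)] vectors.
   For each of these vectors, a zero forces every pivot coefficient into an
   interval of length of order [delta] determined by the other coefficients,
   which by independence has probability of order [delta^n].  The union bound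
   gives [C (l + 1)^(n - 1) exp(-l)], which is small for large [l]. *)

(** * Finite unions of events and the standard Gaussian law *)

Lemma fsbig_finType (V : Type) (idx : V) (op : Monoid.com_law idx) (I : finType)
    (Q : {pred I}) (F : I -> V) :
  \big[op/idx]_(i \in [set` Q]) F i = \big[op/idx]_(i | Q i) F i.
Proof.
apply/esym/bigfs; first exact: index_enum_uniq.
by move=> i _; rewrite mem_index_enum.
Qed.

Lemma fin_bigcup_le d (T : measurableType d) (R : realType)
    (P : probability T R) (I : finType) (Q : {pred I}) (F : I -> set T) :
  (forall i, measurable (F i)) ->
  (P (\bigcup_(i in [set` Q]) F i) <= \sum_(i | Q i) P (F i))%E.
Proof.
move=> mF; have mU := fin_bigcup_measurable (@finite_finset _ [set` Q])
  (fun i _ => mF i).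
have := content_sub_fsum P (@finite_finset _ [set` Q]) (fun i _ => mF i) mU
  (@subset_refl _ _).
by rewrite fsbig_finType.
Qed.

Lemma fin_trivIset_le1 d (T : measurableType d) (R : realType)
    (P : probability T R) (I : finType) (F : I -> set T) :
  (forall i, measurable (F i)) -> trivIset [set: I] F ->
  \sum_i fine (P (F i)) <= 1.
Proof.
move=> mF tF; rewrite -lee_fin -sumEFin.
under eq_bigr do rewrite fineK ?fin_num_measure//.
rewrite -fsbig_finType (_ : [set` _] = [set: I]); last by apply/seteqP; split.
rewrite -measure_fin_bigcup//; last exact: finite_finset.
apply: probability_le1; apply: fin_bigcup_measurable => //.
exact: finite_finset.
Qed.

(** The peak [1 / sqrt (2 pi)] of the density is below 1, so Lebesgue measure dominates the Gaussian
    law. *)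
Lemma normal_prob_itv_le (R : realType) (a b : R) : a <= b ->
  (normal_prob 0 1 `[a, b] <= (b - a)%:E)%E.
Proof.
move=> ab; rewrite /normal_prob.
have <- : (\int[lebesgue_measure]_(x in `[a, b]) cst 1%E x = (b - a)%:E)%E.
  rewrite integral_cst//= mul1e lebesgue_measure_itv/= lte_fin.
  by case: ltgtP ab => // -> _; rewrite subrr.
apply: ge0_le_integral => //.
- by move=> x _; rewrite lee_fin normal_pdf_ge0.
- by apply/measurable_EFinP; apply: measurable_funTS; exact: measurable_normal_pdf.
- move=> x _; rewrite lee_fin (le_trans (normal_pdf_ub _ _ _)) ?oner_neq0//.
  rewrite /normal_peak invf_le1 ?expr1n ?mul1r.
    rewrite -[leLHS]sqrtr1 ler_wsqrtr//; have := pi_ge2 R.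
    by rewrite mulr2n; lra.
  by rewrite sqrtr_gt0; have := pi_gt0 R; rewrite mulr2n; lra.
Qed.

Lemma measurable_norm_gt (R : realType) (M : R) :
  measurable [set x : R | M < `|x|].
Proof.
have mnorm : measurable_fun [set: R] (@Num.norm R R) by exact: normr_measurable.
have := mnorm measurableT `]M, +oo[%classic (measurable_itv _).
congr measurable; apply/seteqP.
by split => y; rewrite /= in_itv/= andbT => -[].
Qed.

(** Continuity from above along the sets [F m], which decrease to the empty set. *)
Lemma normal_prob_tail (R : realType) (e : R) : 0 < e ->
  exists2 M : R, 0 < M & (normal_prob 0 1 [set x | (M < `|x|)%R] <= e%:E)%E.
Proof.
move=> e0; pose F (m : nat) : set R := [set x | m%:R < `|x|].
have capF : \bigcap_m F m = set0.
  apply/seteqP; split => // x /(_ (Num.truncn `|x|).+1 Logic.I).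
  by rewrite /F /= ltNge ltW// truncnS_gt.
have mF m : measurable (F m) by exact: measurable_norm_gt.
have fin m : (normal_prob 0 1 (F m) < +oo)%E.
  apply: le_lt_trans (ltry _).
  exact: (@probability_le1 _ _ R (@normal_prob R 0 1) _ (mF m)).
have : (normal_prob 0 1 \o F) m @[m --> \oo] --> normal_prob 0 1 (\bigcap_m F m).
  apply: (@nonincreasing_cvg_mu _ _ _ (@normal_prob R 0 1) F) => //.
    exact: fin.
    by rewrite capF.
  move=> i j ij; apply/subsetPset => x; apply: le_lt_trans.
  by rewrite ler_nat.
rewrite capF measure0 => /fine_cvgP[_] /cvgr0_norm_lt/(_ e e0)[m _].
move=> /(_ m.+1 (leqnSn m)) /=.
set p := normal_prob 0 1 (F m.+1) => pe; exists m.+1%:R => //.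
have pfin : p \is a fin_num.
  by rewrite ge0_fin_numE ?fin ?(measure_ge0 (@normal_prob R 0 1)).
rewrite -/(F m.+1) -/p -(fineK pfin) lee_fin.
exact: le_trans (ler_norm _) (ltW pe).
Qed.

(** * Anticoncentration of the pivot coefficients *)

(* Cutting the range of the coefficients into cells of length [rho] turns the
   event into a union of rectangles, to which independence applies directly;
   in each of them the pivots are confined to intervals of length
   [2 (#|K| + 1) rho]. *)
Lemma anticoncentration d (T : measurableType d) (R : realType)
    (P : probability T R) (n : nat) (K : finType) (X : K -> {RV P >-> R})
    (pi : K -> 'I_n) (piv : 'I_n -> K) (x : K -> R) (M rho : R) :
  mutually_independent X ->
  (forall k a b, a <= b -> (P (X k @^-1` `[a, b]) <= (b - a)%:E)%E) ->
  cancel piv pi -> 0 < M -> 0 < rho -> (forall k, 0 <= x k <= 1) ->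
  exists2 G : set T, measurable G /\
    (P G <= ((2 * (#|K|%:R + 1) * rho) ^+ n)%:E)%E &
    [set t | (forall k, `|X k t| <= M) /\
      forall i, `|X (piv i) t
        + \sum_(k | (pi k == i) && (k != piv i)) x k * X k t| <= rho] `<=` G.
Proof.
move=> indX small pivK M0 rho0 x01.
(* Half-width of the pivot intervals: [rho] from the allowed residual, [#|K| * rho] from replacing
   the other coefficients by the left ends of their cells. *)
pose w := (#|K|%:R + 1) * rho.
have w0 : 0 < w by rewrite mulr_gt0// ltr_wpDl.
(* Number of cells of length [rho], starting at [- M], that suffice to cover [[- M, M]]. *)
pose H := (Num.truncn (2 * M / rho)).+1.
pose c (j : 'I_H) : R := - M + j%:R * rho.
pose cell (j : 'I_H) : set R := `[c j, c j + rho[%classic.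
pose ispiv k := k == piv (pi k).
pose s (z : {ffun K -> 'I_H}) i :=
  \sum_(k | (pi k == i) && (k != piv i)) x k * c (z k).
pose B (z : {ffun K -> 'I_H}) k : set R :=
  if ispiv k then `[- s z (pi k) - w, - s z (pi k) + w]%classic else cell (z k).
(* The cell index of a pivot is frozen to [ord0], so that the union runs only over the cells of the
   other coefficients. *)
pose Q k : pred 'I_H := if ispiv k then pred1 ord0 else predT.
pose Rz z := \bigcap_(k in [set` [set: K]%SET]) (X k @^-1` B z k).
have mB z k : measurable (B z k).
  by rewrite /B; case: ifP => _; apply: measurable_itv.
have mXB z k : measurable (X k @^-1` B z k).
  by rewrite -[X in measurable X]setTI; apply: measurable_funP.
have mRz z : measurable (Rz z).
  by apply: fin_bigcap_measurable => //; exact: finite_finset.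
pose cl k j := fine (P (X k @^-1` cell j)).
have mcl k j : measurable (X k @^-1` cell j).
  by rewrite -[X in measurable X]setTI; apply: measurable_funP => //;
     apply: measurable_itv.
exists (\bigcup_(z in [set` family Q]) Rz z); last first.
  move=> t [tM tpiv].
  have tj k : ((Num.truncn ((X k t + M) / rho)) < H)%N.
    rewrite ltnS le_truncn// ler_pM2r ?invr_gt0//.
    by have := tM k; rewrite ler_norml; lra.
  pose z := [ffun k => if ispiv k then ord0 else Ordinal (tj k)].
  exists z.
    apply/familyP => k; rewrite ffunE /Q /=.
    by case: ifP.
  have zc k : ~~ ispiv k -> c (z k) <= X k t < c (z k) + rho.
    move=> /negbTE kp; rewrite /c ffunE kp /=.
    have u0 : 0 <= (X k t + M) / rho.
      by rewrite divr_ge0 ?(ltW rho0)//; have := tM k; rewrite ler_norml; lra.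
    have /andP[h1 h2] := truncn_itv u0.
    rewrite ler_pdivlMr// in h1; rewrite ltr_pdivrMr// -natr1 mulrDl mul1r in h2.
    by apply/andP; split; lra.
  move=> k _; rewrite /B /=; case: ifPn => [/eqP kp|kp]; last first.
    by rewrite /cell /= in_itv/= zc.
  have -> : X k t = X (piv (pi k)) t by rewrite -kp.
  rewrite /= in_itv/=.
  set i := pi k; have := tpiv i.
  set S := \sum_(_ | _) _ => ti.
  (* Each coefficient is within [rho] of the left end of its cell, and the weights [x k] are at most
     1. *)
  suff : `|s z i - S| <= #|K|%:R * rho.
    by rewrite /w; move: ti; rewrite !ler_norml mulrDl mul1r; lra.
  rewrite /s /S -sumrB (le_trans (ler_norm_sum _ _ _))//.
  apply: (@le_trans _ _ (\sum_(k in K) rho)); last first.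
    by rewrite sumr_const mulr_natl.
  rewrite big_mkcond/=; apply: ler_sum => j _; case: ifPn => [|_]; last exact: ltW.
  move=> /andP[/eqP ji jp].
  have /zc : ~~ ispiv j by rewrite /ispiv ji.
  rewrite -mulrBr normrM => /andP[c1 c2].
  have /andP[x0 x1] := x01 j.
  rewrite (ger0_norm x0) (le_trans (ler_piMl _ x1))// ler_norml; lra.
have mU : measurable (\bigcup_(z in [set` family Q]) Rz z).
  by apply: fin_bigcup_measurable => //; exact: finite_finset.
split => //.
apply: (le_trans (fin_bigcup_le _ _ mRz)).
pose p k j := if ispiv k then 2 * w else cl k j.
apply: (@le_trans _ _ (\sum_(z in family Q) (\prod_k p k (z k))%:E)%E).
  apply: lee_sum => z _; rewrite /Rz indX; last by move=> k _; exact: mB.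
  rewrite -(@prodEFin R).
  rewrite (eq_bigl xpredT); last by move=> k; rewrite finset.in_setT.
  rewrite (eq_bigr (fun k => (fine (P (X k @^-1` B z k)))%:E)); last first.
    by move=> k _; rewrite fineK ?fin_num_measure.
  rewrite !prodEFin lee_fin; apply: ler_prod => k _.
  rewrite fine_ge0 ?measure_ge0//= /p -lee_fin fineK ?fin_num_measure//.
  rewrite /B; case: ifP => kp; last by rewrite /cl fineK ?fin_num_measure.
  apply: (le_trans (small _ _ _ _)); first by lra.
  by rewrite lee_fin; lra.
(* The sum over all rectangles factors over [k]: a pivot contributes [2 * w], any other index the
   total mass of disjoint cells, at most 1. *)
rewrite sumEFin lee_fin -(bigA_distr_big_dep Q p).
apply: (@le_trans _ _ (\prod_k if ispiv k then 2 * w else 1)).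
  apply: ler_prod => k _; rewrite /p /Q; case: ifP => kp.
    by rewrite big_pred1_eq lexx mulr_ge0 ?(ltW w0).
  rewrite sumr_ge0 /=; last by move=> j _; apply: fine_ge0.
  apply: fin_trivIset_le1 => //.
  move=> j1 j2 _ _ [t []]; rewrite /cell /= !in_itv/= /c => /andP[a1 a2] /andP[b1 b2].
  have lt1 (a b : R) : - M + a * rho < - M + b * rho + rho -> a < b + 1.
    by move=> h; rewrite -(ltr_pM2r rho0) mulrDl mul1r; lra.
  have := lt1 _ _ (le_lt_trans a1 b2); have := lt1 _ _ (le_lt_trans b1 a2).
  rewrite !natr1 !ltr_nat !ltnS => h1 h2.
  by apply/val_inj/eqP; rewrite eqn_leq h1 h2.
rewrite -big_mkcond/= (reindex_onto piv pi) => [|k /eqP//].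
rewrite (eq_bigl xpredT); last by move=> i; rewrite /ispiv pivK !eqxx.
by rewrite prodr_const card_ord /w mulrA.
Qed.

(** * Elementary estimates for inner products, norms and exponentials *)

Lemma dotBl (R : realType) (n : nat) (a b u : 'rV[R]_n) :
  dot (a - b) u = dot a u - dot b u.
Proof.
by rewrite /dot -sumrB; apply: eq_bigr => j _; rewrite !mxE mulrBl.
Qed.

Lemma euclidean_norm_le_sum (R : realType) (n : nat) (u : 'rV[R]_n) :
  euclidean_norm u <= \sum_j `|u 0 j|.
Proof.
have S0 : 0 <= \sum_j `|u 0 j| by apply: sumr_ge0.
rewrite /euclidean_norm -[leRHS]ger0_norm// -sqrtr_sqr ler_wsqrtr//.
rewrite /dot expr2 mulr_suml; apply: ler_sum => j _.
rewrite -expr2 -normr_id -real_normK ?num_real// normr_id expr2.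
by rewrite ler_wpM2l// (bigD1 j)//= lerDl sumr_ge0.
Qed.

Lemma mulmx_norm_le (R : realType) (m n : nat) (A : 'M[R]_(m, n)) (y : 'cV[R]_n)
    (L : R) : 0 <= L -> (forall k, `|y k 0| <= L) ->
  forall i, `|(A *m y) i 0| <= (\sum_i \sum_j `|A i j|) * L.
Proof.
move=> L0 yL i; rewrite mxE (le_trans (ler_norm_sum _ _ _))//.
apply: (@le_trans _ _ ((\sum_j `|A i j|) * L)).
  by rewrite mulr_suml; apply: ler_sum => j _; rewrite normrM ler_wpM2l.
rewrite ler_wpM2r// [leRHS](bigD1 i)//= lerDl.
by apply: sumr_ge0 => k _; apply: sumr_ge0.
Qed.

Lemma expR_dist_le (R : realType) (s t : R) : s <= 0 -> t <= 0 ->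
  `|expR s - expR t| <= `|s - t|.
Proof.
wlog st : s t / t <= s => [H s0 t0|s0 _].
  by case: (leP t s) => [|/ltW] st; [|rewrite distrC [leRHS]distrC]; exact: H.
rewrite !ger0_norm ?subr_ge0 ?ler_expR//.
have -> : expR s - expR t = expR s * (1 - expR (t - s)).
  by rewrite mulrBr mulr1 -expRD subrKC.
have e1 : expR s <= 1 by rewrite -expR0 ler_expR.
have := expR_ge1Dx (t - s) => h.
have h' : 0 <= 1 - expR (t - s) by rewrite subr_ge0 -expR0 ler_expR subr_le0.
by apply: le_trans (ler_piMl h' e1) _; lra.
Qed.

(** * Discretization of the vectors of exponentials *)

(** The rank normal form gives a projection onto the column space that factors through [p]
    coordinates; hence [V *m D] supplies [p] parameters from which [W] recovers [D]. *)
Lemma low_rank_factor (F : fieldType) (N p : nat) (D : 'M[F]_(N, p.+1)) :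
  (\rank D <= p)%N ->
  exists (W : 'M[F]_(N, p)) (V : 'M[F]_(p, N)), W *m (V *m D) = D.
Proof.
move=> rp; exists (col_ebase D *m pid_mx (\rank D)).
exists (pid_mx (\rank D) *m invmx (col_ebase D)).
rewrite -[in X in _ *m (_ *m X)](mulmx_ebase D) !mulmxA.
rewrite mulmxKV ?col_ebase_unit//.
rewrite -(mulmxA (col_ebase D)) pid_mx_id// -(mulmxA (col_ebase D)).
by rewrite pid_mx_id ?rank_leq_row ?mulmx_ebase.
Qed.

(* Either [D] has full column rank, and then [u] is controlled by [D u], or
   [D u] only depends on [p] bounded parameters, which are discretized with
   step [delta]. *)
Lemma grid_cover (R : realType) (N p : nat) (D : 'M[R]_(N, p.+1)) :
  exists2 C : R, 0 < C & forall L delta : R, 0 <= L -> 0 < delta <= 1 ->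
  exists H : nat, H%:R * delta <= C * (L + 1) /\
  exists s : {ffun 'I_p -> 'I_H} -> 'cV[R]_N,
  forall u : 'rV[R]_p.+1, C * L < euclidean_norm u ->
    (forall k, `|(D *m u^T) k 0| <= L) ->
  exists g, forall k, `|s g k 0 - (D *m u^T) k 0| <= C * delta.
Proof.
have [fullD|nfullD] := boolP (row_full D).
  (* The left inverse [V] bounds the norm of [u] by [C * L], so no [u] meets both hypotheses and a
     trivial grid will do. *)
  have [V VD] := row_fullP fullD.
  pose cV : R := \sum_i \sum_j `|V i j|.
  have cV0 : 0 <= cV by apply: sumr_ge0 => i _; apply: sumr_ge0.
  exists (p.+1%:R * cV + 1); first by rewrite ltr_wpDl// mulr_ge0.
  move=> L delta L0 /andP[d0 d1]; exists 1%N; split.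
    have := mulr_ge0 (ler0n R p.+1) cV0; set z := _ * cV => z0.
    by rewrite mul1r; nra.
  exists (fun=> 0) => u; rewrite ltNge => /negP + uL; case.
  apply: (le_trans (euclidean_norm_le_sum u)).
  apply: (@le_trans _ _ (\sum_(j < p.+1) cV * L)).
    apply: ler_sum => j _.
    have -> : u 0 j = (V *m (D *m u^T)) j 0 by rewrite mulmxA VD mul1mx mxE.
    exact: mulmx_norm_le.
  rewrite sumr_const card_ord -[leLHS]mulr_natl mulrA ler_wpM2r//.
  by rewrite lerDl.
have rD : (\rank D <= p)%N by rewrite -ltnS ltn_neqAle nfullD rank_leq_col.
have [W [V WVD]] := low_rank_factor rD.
pose cV : R := \sum_i \sum_j `|V i j|; pose cW : R := \sum_i \sum_j `|W i j|.
have cV0 : 0 <= cV by apply: sumr_ge0 => i _; apply: sumr_ge0.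
have cW0 : 0 <= cW by apply: sumr_ge0 => i _; apply: sumr_ge0.
(* [cW] controls the error, [2 * cV] the length of the parameter range, and 1 the extra cell due to
   rounding. *)
exists (cW + 2 * cV + 1); first by lra.
move=> L delta L0 /andP[d0 d1].
pose H := (Num.truncn (2 * (cV * L) / delta)).+1.
have cL0 : 0 <= cV * L by apply: mulr_ge0.
exists H; split.
  have /truncn_itv/andP[+ _] : 0 <= 2 * (cV * L) / delta.
    by rewrite divr_ge0 ?(ltW d0)//; lra.
  by rewrite ler_pdivlMr// /H -natr1 mulrDl mul1r; nra.
(* The parameters [y = V D u] lie in [[- cV L, cV L]]; they are rounded down to the grid of step
   [delta] and mapped back by [W]. *)
exists (fun g : {ffun 'I_p -> 'I_H} =>
  W *m \col_j (- (cV * L) + (g j)%:R * delta)) => u _ uL.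
have [y yE] : exists y, y = V *m (D *m u^T) by exists (V *m (D *m u^T)).
have yL j : `|y j 0| <= cV * L by rewrite yE; exact: mulmx_norm_le.
have gj j : (Num.truncn ((y j 0 + cV * L) / delta)%R < H)%N.
  rewrite ltnS le_truncn// ler_pM2r ?invr_gt0//.
  by have := yL j; rewrite ler_norml; lra.
exists [ffun j => Ordinal (gj j)] => k.
have -> : D *m u^T = W *m y by rewrite yE !mulmxA -(mulmxA W) WVD.
set a := \col_j _.
have -> : (W *m a) k 0 - (W *m y) k 0 = (W *m (a - y)) k 0.
  by rewrite mulmxBr [RHS]mxE [X in _ = _ + X]mxE.
apply: (@le_trans _ _ (cW * delta)); last by rewrite ler_wpM2r ?(ltW d0)//; lra.
apply: mulmx_norm_le; first exact: ltW.
move=> j; rewrite !mxE ffunE /=.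
have u0 : 0 <= (y j 0 + cV * L) / delta.
  by rewrite divr_ge0 ?(ltW d0)//; have := yL j; rewrite ler_norml; lra.
have /andP[h1 h2] := truncn_itv u0.
rewrite ler_pdivlMr// in h1; rewrite ltr_pdivrMr// -natr1 mulrDl mul1r in h2.
by rewrite ler_norml; lra.
Qed.

(** A point [th] of [Theta] records a choice of pivots and the set of exponentials that are kept.
    Each [th] has its own grid, and [I] is the disjoint union of these grids; as [Theta] does not
    depend on [l], its size is absorbed into [C]. *)
Lemma exponential_cover (R : realType) (p : nat) (K : finType)
    (pi : K -> 'I_p.+1) (pi0 : 'I_p.+1 -> K) (v : K -> 'rV[R]_p.+1) :
  cancel pi0 pi ->
  exists2 C : R, 0 < C & forall l : nat,
  exists (I : finType) (piv : I -> 'I_p.+1 -> K) (x : I -> K -> R),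
  [/\ forall q, cancel (piv q) pi,
      forall q k, 0 <= x q k <= 1,
      #|I|%:R * expR (- l%:R) ^+ p <= C * l.+1%:R ^+ p &
      forall u : 'rV[R]_p.+1, C * l%:R < euclidean_norm u ->
      exists q, forall k, `|x q k - expR (dot (v k - v (piv q (pi k))) u)|
        <= C * expR (- l%:R)].
Proof.
move=> pi0K.
pose Theta := ({ffun 'I_p.+1 -> K} * {set K})%type.
(* An arbitrary [f] is corrected by [pi0] into a section of [pi], so that [Theta] may contain all
   functions. *)
pose pv (f : {ffun 'I_p.+1 -> K}) i := if pi (f i) == i then f i else pi0 i.
pose df (th : Theta) k := v k - v (pv th.1 (pi k)).
(* Rows of discarded indices vanish, so a bound on [D u] constrains only the kept exponents. *)
pose D (th : Theta) : 'M[R]_(#|K|, p.+1) := \matrix_(k, j)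
  (if enum_val k \in th.2 then df th (enum_val k) 0 j else 0).
have pvK f : cancel (pv f) pi.
  by move=> i; rewrite /pv; case: eqP => // _; exact: pi0K.
have DE th u k : (D th *m u^T) (enum_rank k) 0 =
    if k \in th.2 then dot (df th k) u else 0.
  rewrite mxE /dot; case: ifP => kS.
    by apply: eq_bigr => j _; rewrite !mxE enum_rankK kS.
  by rewrite big1// => j _; rewrite !mxE enum_rankK kS mul0r.
have /choice[C0 CP] th : exists C : R, 0 < C /\
    forall L delta : R, 0 <= L -> 0 < delta <= 1 ->
    exists H : nat, H%:R * delta <= C * (L + 1) /\
    exists s : {ffun 'I_p -> 'I_H} -> 'cV[R]_#|K|,
    forall u : 'rV[R]_p.+1, C * L < euclidean_norm u ->
      (forall k, `|(D th *m u^T) k 0| <= L) ->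
    exists g, forall k, `|s g k 0 - (D th *m u^T) k 0| <= C * delta.
  by have [C C0 ?] := grid_cover (D th); exists C.
have C00 th : 0 < C0 th by have [] := CP th.
(* The 1 serves the discarded exponentials, the first sum the radii and grid errors, the second the
   cardinality of [I]. *)
pose C := 1 + \sum_th C0 th + \sum_th C0 th ^+ p.
have sC0 : 0 <= \sum_th C0 th by apply: sumr_ge0 => th _; exact: ltW.
have sCp : 0 <= \sum_th C0 th ^+ p.
  by apply: sumr_ge0 => th _; apply: exprn_ge0; exact: ltW.
have C1 : 1 <= C by rewrite /C; lra.
have CC0 th : C0 th <= C.
  apply: (@le_trans _ _ (\sum_th C0 th)); last by rewrite /C; lra.
  rewrite (bigD1 th)//= lerDl; apply: sumr_ge0 => j _; exact: ltW.
exists C => [|l]; first by lra.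
have d0 : 0 < expR (- l%:R) :> R by exact: expR_gt0.
have d1 : expR (- l%:R) <= 1 :> R by rewrite -expR0 ler_expR oppr_le0.
have /choice[H HP] th : exists H : nat,
    H%:R * expR (- l%:R) <= C0 th * (l%:R + 1) /\
    exists s : {ffun 'I_p -> 'I_H} -> 'cV[R]_#|K|,
    forall u : 'rV[R]_p.+1, C0 th * l%:R < euclidean_norm u ->
      (forall k, `|(D th *m u^T) k 0| <= l%:R) ->
    exists g, forall k, `|s g k 0 - (D th *m u^T) k 0| <= C0 th * expR (- l%:R).
  by apply: (proj2 (CP th)) => //; rewrite d0.
pose s th := sval (cid (proj2 (HP th))).
have sP th : forall u : 'rV[R]_p.+1, C0 th * l%:R < euclidean_norm u ->
      (forall k, `|(D th *m u^T) k 0| <= l%:R) ->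
    exists g, forall k, `|s th g k 0 - (D th *m u^T) k 0| <= C0 th * expR (- l%:R).
  exact: svalP (cid (proj2 (HP th))).
pose I : finType := {th : Theta & {ffun 'I_p -> 'I_(H th)}}.
(* Truncating at 0 keeps the values in [[0, 1]] and brings them no further from the true exponents,
   which are nonpositive. *)
exists I, (fun q : I => pv (tag q).1), (fun (q : I) (k : K) =>
  if k \in (tag q).2 then expR (Num.min 0 (s (tag q) (tagged q) (enum_rank k) 0))
  else 0); split.
- by move=> q; exact: pvK.
- move=> q k; case: ifP => _; last by rewrite lexx ler01.
  by rewrite expR_ge0 -[leRHS]expR0 ler_expR ge_min lexx.
- have -> : #|I| = (\sum_th H th ^ p)%N.
    rewrite card_tagged sumnE big_map big_enum/=.
    by apply: eq_bigr => th _; rewrite card_ffun !card_ord.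
  rewrite natr_sum mulr_suml.
  apply: (@le_trans _ _ (\sum_th C0 th ^+ p * l.+1%:R ^+ p)).
    apply: ler_sum => th _; rewrite natrX -!exprMn.
    have [+ _] := HP th; rewrite natr1 => h.
    by rewrite lerXn2r ?nnegrE// mulr_ge0// ltW.
  rewrite -mulr_suml ler_wpM2r ?exprn_ge0//; rewrite /C; lra.
move=> u Clu.
(* The pivot of equation [i] is an index whose exponential at [u] is largest. *)
pose f : {ffun 'I_p.+1 -> K} :=
  [ffun i => [arg max_(k > pi0 i | pi k == i) dot (v k) u]%O].
have fP i : pi (f i) = i /\ forall k, pi k = i -> dot (v k) u <= dot (v (f i)) u.
  rewrite ffunE; case: arg_maxP => [|k /eqP ki km]; first by rewrite pi0K.
  by split => // j ji; apply: km; rewrite ji.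
have pf i : pv f i = f i by rewrite /pv (proj1 (fP i)) eqxx.
have fmax k : dot (v k) u <= dot (v (pv f (pi k))) u.
  by rewrite pf; apply: (proj2 (fP (pi k))).
pose th : Theta := (f, [set k | - l%:R <= dot (v k - v (pv f (pi k))) u]%SET).
have df0 k : dot (df th k) u <= 0 by rewrite /df dotBl subr_le0 fmax.
have th2 k : (k \in th.2) = (- l%:R <= dot (df th k) u) by rewrite inE.
have [||g gP] := sP th u.
- by apply: le_lt_trans Clu; rewrite ler_wpM2r.
- move=> k; rewrite -(enum_valK k) DE th2; case: ifP => h; last by rewrite normr0.
  by rewrite ler0_norm// lerNl.
exists (Tagged (fun th => {ffun 'I_p -> 'I_(H th)}) g : I) => /= k.
rewrite -/(df th k); have := gP (enum_rank k); rewrite DE th2.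
case: ifPn => [kS h|]; last first.
  rewrite -ltNge sub0r normrN => /ltW h _.
  rewrite ger0_norm ?expR_ge0// (le_trans (_ : _ <= expR (- l%:R)))//.
    by rewrite ler_expR.
  by rewrite ler_peMl.
apply: (@le_trans _ _ (C0 th * expR (- l%:R))); last by rewrite ler_wpM2r// ltW.
apply: le_trans h; apply: le_trans (expR_dist_le _ _) _ => //.
  by rewrite ge_min lexx.
set z := s th _ _ _; have := df0 k; set w := dot _ _ => w0.
have [z0|z0] := leP 0 z => //; rewrite !ger0_norm; lra.
Qed.

(** * Measurability of the event that a zero exists *)

Lemma continuous_dot (R : realType) (n : nat) (f g : 'rV[R]_n -> 'rV[R]_n) :
  continuous f -> continuous g -> continuous (fun u => dot (f u) (g u)).
Proof.
move=> cf cg; apply: continuous_big => [|k _]; first exact: add_continuous.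
move=> u; apply: (@continuousM _ _ (fun u => f u 0 k) (fun u => g u 0 k)).
  exact: (continuous_comp (cf u) (@coord_continuous R 1 n 0 k (f u))).
exact: (continuous_comp (cg u) (@coord_continuous R 1 n 0 k (g u))).
Qed.

Lemma continuous_euclidean_norm (R : realType) (n : nat) :
  continuous (@euclidean_norm R n).
Proof.
move=> u; apply: continuous_comp; last exact: sqrt_continuous.
by apply: (continuous_dot (f := id) (g := id)) => // ?; exact: cvg_id.
Qed.

Lemma coord_le_euclidean_norm (R : realType) (n : nat) (u : 'rV[R]_n) j :
  `|u 0 j| <= euclidean_norm u.
Proof.
rewrite -sqrtr_sqr ler_wsqrtr// /dot (bigD1 j)//= -expr2 lerDl.
by apply: sumr_ge0 => k _; rewrite -expr2 sqr_ge0.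
Qed.

Lemma compact_euclidean_annulus (R : realType) (n : nat) (a b : R) :
  compact [set u : 'rV[R]_n | a <= euclidean_norm u <= b].
Proof.
have cN := @continuous_euclidean_norm R n.
apply: (@subclosed_compact _ _ [set u : 'rV[R]_n | forall j, `[- b, b]%classic (u 0 j)]).
- have -> : [set u : 'rV[R]_n | a <= euclidean_norm u <= b] =
      (@euclidean_norm R n) @^-1` `[a, b]%classic.
    by apply/seteqP; split => u; rewrite /= in_itv.
  by apply: preimage_closed => //; exact: interval_closed.
- apply: (@rV_compact R n (fun=> `[- b, b]%classic)) => _; exact: segment_compact.
- move=> u /andP[_ ub] j /=; rewrite in_itv/= -ler_norml.
  exact: le_trans (coord_le_euclidean_norm _ _) ub.
Qed.

Lemma rational_row_dense (R : realType) (n : nat) (w : 'rV[R]_n)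
    (U : set 'rV[R]_n) :
  nbhs w U -> exists q : 'rV[rat]_n, U (map_mx ratr q).
Proof.
move=> /nbhs_ballP[e /= e0 wU].
have /choice[q qP] j : exists q : rat, `|w 0 j - ratr q| < e.
  have /rat_in_itvoo[q] : w 0 j - e < w 0 j + e by lra.
  by rewrite in_itv/= => qe; exists q; rewrite ltr_norml; lra.
exists (\row_j q j); apply: wU; split => // i j.
by rewrite /ball/= ord1 !mxE.
Qed.

(* The zero set need not project to a measurable set a priori: the existential
   quantifier is reduced to countable operations by compactness of annuli and
   density of the rational points. *)
Lemma measurable_exists_zero d (T : measurableType d) (R : realType) (n : nat)
    (g : T -> 'rV[R]_n -> R) (r : R) :
  (forall t, continuous (g t)) -> (forall u, measurable_fun setT (g ^~ u)) ->
  measurable [set t | exists u, r < euclidean_norm u /\ g t u = 0].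
Proof.
move=> cg mg.
pose inv_succ (k : nat) : R := k.+1%:R^-1.
pose annulus k (u : 'rV[R]_n) := r + inv_succ k <= euclidean_norm u <= k%:R.
pose rq (q : 'rV[rat]_n) : 'rV[R]_n := map_mx ratr q.
have -> : [set t | exists u, r < euclidean_norm u /\ g t u = 0] =
    \bigcup_k \bigcap_j \bigcup_q
      [set t | annulus k (rq q) && (`|g t (rq q)| < inv_succ j)].
  apply/seteqP; split => [t [u [ru gu]]|t [k _ tk]].
    (* [k] is so large that [u] lies strictly inside the annulus, which leaves room for nearby
       rational points. *)
    pose k := maxn (Num.truncn (euclidean_norm u)).+1
                   (Num.truncn (euclidean_norm u - r)^-1).+1.
    have nk : euclidean_norm u < k%:R.
      apply: lt_le_trans (truncnS_gt _) _; by rewrite ler_nat leq_maxl.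
    have rk : r + inv_succ k < euclidean_norm u.
      rewrite -ltrBrDl /inv_succ invf_plt ?posrE ?subr_gt0//.
      apply: lt_le_trans (truncnS_gt _) _.
      by rewrite ler_nat (leq_trans (leq_maxr _ _) (leqnSn _)).
    exists k => // j _.
    have cN := @continuous_euclidean_norm R n u.
    have [q [q1 q2 q3]] : exists q, [/\ r + inv_succ k < euclidean_norm (rq q),
        euclidean_norm (rq q) < k%:R & `|g t (rq q)| < inv_succ j].
      apply: (@rational_row_dense R n u [set u' |
        [/\ r + inv_succ k < euclidean_norm u', euclidean_norm u' < k%:R &
          `|g t u'| < inv_succ j]]).
      have g0 : `|g t u'| @[u' --> u] --> `|g t u|
        by exact: (continuous_comp (cg t u) (@norm_continuous R R (g t u))).
      near=> u'; split; near: u'.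
      - exact: (cvgr_gt (euclidean_norm u)).
      - exact: (cvgr_lt (euclidean_norm u)).
      - by apply: (cvgr_lt `|g t u|) => //; rewrite gu normr0 invr_gt0.
    by exists q => //=; rewrite /annulus !ltW.
  pose A := [set u : 'rV[R]_n | annulus k u].
  (* The image of the annulus is closed, so it contains 0 as soon as it contains arbitrarily small
     values. *)
  have : compact (g t @` A).
    apply: continuous_compact; last exact: compact_euclidean_annulus.
    exact: continuous_subspaceT.
  move=> /(compact_closed (@Rhausdorff R)) /(_ 0) [].
    move=> B /nbhs_ballP[e /= e0 eB].
    have [q _ /=] := tk (Num.truncn e^-1) Logic.I.
    move=> /andP[qA gq]; exists (g t (rq q)); split; first by exists (rq q).
    apply: eB; rewrite /ball/= sub0r normrN; apply: lt_trans gq _.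
    by rewrite /inv_succ invf_plt ?posrE// truncnS_gt.
  move=> u /andP[ru _] gu; exists u; split => //.
  by apply: lt_le_trans ru; rewrite ltrDl invr_gt0.
apply: bigcupT_measurable => k; apply: bigcapT_measurable => j.
apply: countable_bigcupT_measurable => // q.
case: (annulus k (rq q)); last by rewrite /= set_false.
rewrite -[X in measurable X]setTI /=.
have mn : measurable_fun setT (fun t => `|g t (rq q)|).
  by apply: measurableT_comp => //; exact: normr_measurable.
have := mn measurableT `]-oo, inv_succ j[%classic (measurable_itv _).
by congr measurable; apply/seteqP; split => t [_]; rewrite /= in_itv.
Unshelve. all: by end_near.
Qed.

(** The sum of the absolute values turns the system into a single continuous equation. *)
Lemma measurable_zero_event d (T : measurableType d) (R : realType)
    (P : probability T R) (n : nat) (K : finType) (X : K -> {RV P >-> R})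
    (pi : K -> 'I_n) (v : K -> 'rV[R]_n) (r : R) :
  measurable [set t | exists u, r < euclidean_norm u /\
    forall i, \sum_(k | pi k == i) X k t * expR (dot (v k) u) = 0].
Proof.
pose g t u := \sum_i `|\sum_(k | pi k == i) X k t * expR (dot (v k) u)|.
have -> : [set t | exists u, r < euclidean_norm u /\
    forall i, \sum_(k | pi k == i) X k t * expR (dot (v k) u) = 0] =
    [set t | exists u, r < euclidean_norm u /\ g t u = 0].
  apply/seteqP; split => t [u [ru Fu]]; exists u; split => //.
    by rewrite /g big1// => i _; rewrite Fu normr0.
  move=> i; apply/eqP; rewrite -normr_eq0; apply/eqP.
  by apply: (psumr_eq0P _ Fu).
apply: measurable_exists_zero => [t|u].
  apply: continuous_big => [|i _]; first exact: add_continuous.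
  move=> u; apply: continuous_comp; last exact: norm_continuous.
  apply: continuous_big => [|k _]; first exact: add_continuous.
  move=> {}u; apply: (@continuousM _ _ (fun=> X k t) (fun u => expR (dot (v k) u))).
    exact: cst_continuous.
  have cd : continuous (fun u => dot (v k) u).
    apply: (continuous_dot (f := fun=> v k) (g := id)); first exact: cst_continuous.
    by move=> ?; exact: cvg_id.
  exact: (continuous_comp (cd u) (@continuous_expR R _)).
apply: measurable_sum => i; apply: measurableT_comp => //.
rewrite (_ : (fun t => \sum_(k | pi k == i) X k t * expR (dot (v k) u)) =
    fun t => \sum_k if pi k == i then X k t * expR (dot (v k) u) else 0); last first.
  by apply/funext => t; exact: big_mkcond.
apply: measurable_sum => k; case: (pi k == i) => //.
by apply: measurable_funM.
Qed.

(** * The probability of a zero far from the origin *)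

(** The Taylor term of degree [p + 1] gives [(l + 1)^(p + 1) exp(-l) <= exp(1) (p + 1)!]; dividing
    by [l + 1] leaves a bound of order [1 / (l + 1)]. *)
Lemma polynomial_expR_small (R : realType) (p : nat) (B e : R) :
  0 <= B -> 0 < e -> exists l : nat, B * l.+1%:R ^+ p * expR (- l%:R) <= e.
Proof.
move=> B0 e0; pose b := B * expR 1 * p.+1`!%:R.
have b0 : 0 <= b by rewrite !mulr_ge0 ?expR_ge0.
pose l := Num.truncn (b / e); exists l.
have l0 : 0 < l.+1%:R :> R by rewrite ltr0n.
have lb : b <= e * l.+1%:R.
  rewrite mulrC -ler_pdivrMr//; exact: ltW (truncnS_gt _).
have f0 : 0 < p.+1`!%:R :> R by rewrite ltr0n fact_gt0.
have el : l.+1%:R ^+ p.+1 * expR (- l%:R) <= expR 1 * p.+1`!%:R :> R.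
  have := expR_ge1Dxn p (ltW l0).
  rewrite -(ler_pM2r f0) mulrDl mul1r divfK ?gt_eqF// => h.
  have h' : l.+1%:R ^+ p.+1 <= expR l.+1%:R * p.+1`!%:R :> R.
    by apply: le_trans h; rewrite lerDr ltW.
  apply: (le_trans (ler_wpM2r (expR_ge0 _) h')).
  by rewrite mulrAC -expRD -natr1 addrAC subrr add0r.
rewrite -(ler_pM2r l0); apply: le_trans lb.
have -> : B * l.+1%:R ^+ p * expR (- l%:R) * l.+1%:R =
    B * (l.+1%:R ^+ p.+1 * expR (- l%:R)) by rewrite exprS; ring.
by rewrite /b -mulrA ler_wpM2l.
Qed.

Lemma mutually_independent_inj d (T : measurableType d) (R : realType)
    (P : probability T R) (I J : finType) (phi : I -> J)
    (X : J -> {RV P >-> R}) :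
  injective phi -> mutually_independent X ->
  mutually_independent (fun i => X (phi i)).
Proof.
move=> phi_inj indX S B mB.
(* By injectivity the picked [i] is the only preimage; the default [setT] is never tested, since the
   index set is [phi @: S]. *)
pose B' j := if [pick i | phi i == j] is Some i then B i else setT.
have B'E i : B' (phi i) = B i.
  by rewrite /B'; case: pickP => [k /eqP/phi_inj ->//|/(_ i)]; rewrite eqxx.
have := indX (phi @: S)%SET B'; rewrite big_imset/=; last by move=> ? ? _ _ /phi_inj.
under eq_bigr do rewrite B'E.
move=> <-; last by move=> j /imsetP[i iS ->]; rewrite B'E; exact: mB.
congr (P _); apply/seteqP; split => t H.
  by move=> j /= /imsetP[i iS ->]; rewrite B'E; exact: H.
by move=> i iS; have := H (phi i) (imset_f _ iS); rewrite B'E.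
Qed.

(** The radius is chosen before the probability space, because in the theorem the space varies with
    [m]. Half of [eta] pays for large coefficients, half for the union over the grid. *)
Lemma far_zero_probability_small (R : realType) (p : nat) (K : finType)
    (pi : K -> 'I_p.+1) (pi0 : 'I_p.+1 -> K) (v : K -> 'rV[R]_p.+1) (eta : R) :
  cancel pi0 pi -> 0 < eta ->
  exists r : R, forall d (T : measurableType d) (P : probability T R)
    (X : K -> {RV P >-> R}),
  (forall k, standard_gaussian (X k)) -> mutually_independent X ->
  (P [set t | exists u, (r < euclidean_norm u)%R /\
    forall i, (\sum_(k | pi k == i) X k t * expR (dot (v k) u) = 0)%R]
    <= eta%:E)%E.
Proof.
move=> pi0K eta0; pose N : R := #|K|%:R.
have N0 : 0 < N by rewrite ltr0n; apply/card_gt0P; exists (pi0 ord0).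
have [M M0 tail] : exists2 M : R, 0 < M &
    (normal_prob 0 1 [set x | (M < `|x|)%R] <= (eta / 2 / N)%:E)%E.
  by apply: normal_prob_tail; rewrite !divr_gt0.
have [C C0 cover] := exponential_cover v pi0K.
(* Replacing the exponentials by their grid values changes an equation by at most [kappa * delta];
   anticoncentration then gives pivot intervals of length [a * delta]. *)
pose kappa := N * M * C; pose a := 2 * (N + 1) * kappa.
have kappa0 : 0 < kappa by rewrite !mulr_gt0.
have a0 : 0 < a by rewrite !mulr_gt0// addr_gt0.
have [||l lP] := @polynomial_expR_small R p (a ^+ p.+1 * C) (eta / 2).
- by rewrite mulr_ge0 ?exprn_ge0 ?(ltW a0)// ltW.
- by rewrite divr_gt0.
have [I [piv [x [pivK x01 cardI xP]]]] := cover l.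
set delta : R := expR (- l%:R) in lP cardI xP.
have delta0 : 0 < delta by exact: expR_gt0.
exists (C * l%:R) => d T P X gX indX.
have mXB k (B : set R) : measurable B -> measurable (X k @^-1` B).
  by move=> mB; rewrite -[Y in measurable Y]setTI; exact: measurable_funP.
have small k b b' : b <= b' -> (P (X k @^-1` `[b, b']) <= (b' - b)%:E)%E.
  by move=> bb'; rewrite gX; [exact: normal_prob_itv_le|exact: measurable_itv].
pose A k := X k @^-1` [set y | M < `|y|].
have mA k : measurable (A k) by apply: mXB; exact: measurable_norm_gt.
pose G0 q := [set t | (forall k, `|X k t| <= M) /\
  forall i, `|X (piv q i) t + \sum_(k | (pi k == i) && (k != piv q i))
    x q k * X k t| <= kappa * delta].
have /choice[G GP] q : exists G, [/\ measurable G,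
    (P G <= ((a * delta) ^+ p.+1)%:E)%E & G0 q `<=` G].
  have [G [mG PG] GG] := anticoncentration indX small (pivK q) M0
    (mulr_gt0 kappa0 delta0) (x01 q).
  by exists G; split => //; rewrite mulrA in PG.
have mG q : measurable (G q) by have [] := GP q.
have mU1 : measurable (\bigcup_(k in [set` (predT : {pred K})]) A k).
  by apply: fin_bigcup_measurable => //; exact: finite_finset.
have mU2 : measurable (\bigcup_(q in [set` (predT : {pred I})]) G q).
  by apply: fin_bigcup_measurable => //; exact: finite_finset.
apply: (@le_trans _ _ (P (\bigcup_(k in [set` (predT : {pred K})]) A k `|`
    \bigcup_(q in [set` (predT : {pred I})]) G q))).
  apply: le_measure; rewrite ?inE; [exact: measurable_zero_event|exact: measurableU|].
  move=> t [u [ru Fu]].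
  have [[k kA]|noA] := pselect (exists k, A k t); [left; by exists k|right].
  have XM k : `|X k t| <= M.
    by rewrite leNgt; apply/negP => kA; apply: noA; exists k.
  have [q xq] := xP _ ru; exists q => //.
  have [_ _] := GP q; apply; split => // i.
  pose e k := expR (dot (v k - v (piv q (pi k))) u).
  have : \sum_(k | pi k == i) X k t * e k = 0.
    (* Equation [i] is divided by its pivot exponential. *)
    rewrite (eq_bigr (fun k => X k t * expR (dot (v k) u) *
        expR (- dot (v (piv q i)) u))); last first.
      by move=> k /eqP ki; rewrite /e ki dotBl expRD mulrA.
    by rewrite -mulr_suml Fu mul0r.
  rewrite (bigD1 (piv q i)) ?pivK//= {1}/e pivK dotBl subrr.
  rewrite expR0 mulr1 => /eqP; rewrite addr_eq0 => /eqP ->.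
  (* What remains is the sum of the coefficients times the errors [x q k - e k]. *)
  rewrite addrC -sumrB (le_trans (ler_norm_sum _ _ _))//.
  apply: (@le_trans _ _ (\sum_(k in K) M * (C * delta))); last first.
    by rewrite sumr_const -[leLHS]mulr_natl /kappa -/N !mulrA.
  rewrite big_mkcond/=; apply: ler_sum => k _; case: ifP => _; last first.
    by rewrite !mulr_ge0 ?ltW.
  rewrite mulrC -mulrBr normrM ler_pM//; exact: xq.
apply: (le_trans (measureU2 _ mU1 mU2)).
rewrite [eta](_ : _ = eta / 2 + eta / 2); last by rewrite -splitr.
rewrite EFinD; apply: leeD.
  apply: (le_trans (fin_bigcup_le _ _ mA)).
  apply: (@le_trans _ _ (\sum_(k in K) (eta / 2 / N)%:E)%E).
    by apply: lee_sum => k _; rewrite /A (gX _ _ (measurable_norm_gt M)).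
  by rewrite sumEFin lee_fin sumr_const -[leLHS]mulr_natl mulrC divfK// gt_eqF.
apply: (le_trans (fin_bigcup_le _ _ mG)).
apply: (@le_trans _ _ (\sum_(q in I) ((a * delta) ^+ p.+1)%:E)%E).
  by apply: lee_sum => q _; have [] := GP q.
rewrite sumEFin lee_fin sumr_const -[leLHS]mulr_natl; apply: le_trans lP.
(* The grid costs only [delta^-p] against [delta^(p + 1)], so one factor [delta] is left over. *)
have -> : #|I|%:R * (a * delta) ^+ p.+1 =
    a ^+ p.+1 * (#|I|%:R * delta ^+ p) * delta.
  by rewrite exprMn [delta ^+ p.+1]exprS; ring.
rewrite ler_wpM2r ?(ltW delta0)// -mulrA ler_wpM2l// exprn_ge0//; exact: ltW.
Qed.

(** * Rescaling of the stretched supports and passage to the limit *)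

Theorem theorem1p5 (R : realType) (n : nat) (hn : (0 < n)%N)
    (A : 'I_n -> {fset 'rV[R]_n}) (hA : forall i, A i != fset0)
    (eps : R) (heps : 0 < eps)
    (d : nat -> measure_display)
    (T : forall m : nat, measurableType (d m))
    (P : forall m : nat, probability (T m) R)
    (c : forall (m : nat) (i : 'I_n), stretch m (A i) -> {RV (P m) >-> R})
    (hc : forall m : nat, (0 < m)%N -> iid_standard_gaussian (c m)) :
  (fun m : nat => P m [set t : T m | exists w : 'rV[R]_n,
      eps < euclidean_norm w /\
      forall i : 'I_n, exp_sum (fun b => c m i b t) w = 0])
    @ \oo --> 0%E.
Proof.
case: n hn A hA c hc => // p _ A hA c hc.
pose K : finType := {i : 'I_p.+1 & A i}.
have hmem m i (a : A i) : m%:R *: val a \in stretch m (A i).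
  by apply: in_imfset; exact: valP.
pose h m i (a : A i) : stretch m (A i) := [` hmem m i a]%fset.
have h_inj m i : (0 < m)%N -> injective (@h m i).
  move=> m0 a b /(congr1 val) /= /scalerI ab; apply/val_inj/ab.
  by rewrite pnatr_eq0 -lt0n.
have h_surj m i (b : stretch m (A i)) : exists a, h m i a = b.
  have /imfsetP[/= a aA ba] := valP b.
  by exists [` aA]%fset; apply/val_inj; rewrite /= ba.
have /choice[pi0 pi0K] i : exists k : K, tag k = i.
  have /fset0Pn[a aA] := hA i.
  by exists (Tagged (fun i => A i) [` aA]%fset : {i : 'I_p.+1 & A i}).
(* The coefficients are indexed by the unstretched supports, so that the index type is the same for
   every [m]. *)
pose X m (k : K) : {RV (P m) >-> R} := c m (tag k) (h m (tag k) (tagged k)).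
pose v (k : K) : 'rV[R]_p.+1 := val (tagged k).
have XP m : (0 < m)%N ->
    (forall k, standard_gaussian (X m k)) /\ mutually_independent (X m).
  move=> m0; have [gc ic] := hc m m0; split; first by move=> k; exact: gc.
  pose phi (k : K) : {i : 'I_p.+1 & stretch m (A i)} :=
    Tagged (fun i => stretch m (A i)) (h m (tag k) (tagged k)).
  have phi_inj : injective phi.
    move=> [i a] [j b] /[dup] /(congr1 tag) /= ij; subst j.
    by move=> /eqP; rewrite /phi /= eq_Tagged => /eqP /(h_inj _ _ m0) ->.
  exact: (mutually_independent_inj phi_inj ic).
have eventE m : (0 < m)%N -> [set t : T m | exists w : 'rV[R]_p.+1,
      eps < euclidean_norm w /\
      forall i : 'I_p.+1, exp_sum (fun b => c m i b t) w = 0] =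
    [set t | exists u, m%:R * eps < euclidean_norm u /\
      forall i, \sum_(k | tag k == i) X m k t * expR (dot (v k) u) = 0].
  move=> m0; have mR0 : 0 < m%:R :> R by rewrite ltr0n.
  have normZ (w : 'rV[R]_p.+1) :
      euclidean_norm (m%:R *: w) = m%:R * euclidean_norm w.
    rewrite /euclidean_norm -[in RHS](ger0_norm (ltW mR0)) -sqrtr_sqr.
    rewrite -sqrtrM ?sqr_ge0//.
    congr Num.sqrt; rewrite /dot mulr_sumr; apply: eq_bigr => k _.
    by rewrite !mxE; ring.
  have FE t i (w : 'rV[R]_p.+1) : exp_sum (fun b => c m i b t) w =
      \sum_(k | tag k == i) X m k t * expR (dot (v k) (m%:R *: w)).
    have /choice[g gK] := h_surj m i.
    have hbij : bijective (h m i).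
      by exists g => // a; apply: (h_inj _ _ m0); rewrite gK.
    (* Stated for every [j], so that the sum over the fibre of [tag] becomes a dependent double sum
       restricted to [j == i]. *)
    pose F j (a : A j) := c m j (h m j a) t * expR (dot (val a) (m%:R *: w)).
    transitivity (\sum_(j | j == i) \sum_(a : A j) F j a).
      rewrite big_pred1_eq /exp_sum (reindex (h m i)) /=; last exact: onW_bij.
      apply: eq_bigr => a _; rewrite /F; congr (_ * expR _).
      by apply: eq_bigr => k _; rewrite !mxE; ring.
    rewrite (sig_big_dep (pred1 i) (fun _ _ => true) F).
    by apply: eq_bigl => k; rewrite andbT.
  apply/seteqP; split => t [w [ew Fw]].
    exists (m%:R *: w); rewrite normZ ltr_pM2l//; split => // i.
    by rewrite -FE.
  have wE : w = m%:R *: (m%:R^-1 *: w) by rewrite scalerA divff ?scale1r ?gt_eqF.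
  exists (m%:R^-1 *: w); split; first by rewrite -(ltr_pM2l mR0) -normZ -wE.
  by move=> i; rewrite FE -wE.
have bound eta : 0 < eta -> \forall m \near \oo,
    (P m [set t : T m | exists w : 'rV[R]_p.+1, (eps < euclidean_norm w)%R /\
      forall i : 'I_p.+1, exp_sum (fun b => c m i b t) w = 0%R] <= eta%:E)%E.
  move=> eta0; have [r rP] := far_zero_probability_small v pi0K eta0.
  near=> m.
  have m0 : (0 < m)%N by near: m; exact: nbhs_infty_gt.
  have [gX iX] := XP m m0.
  apply: le_trans (rP _ _ _ _ gX iX); rewrite eventE//.
  apply: le_measure; rewrite ?inE; try exact: measurable_zero_event.
  (* The inclusion of events requires [r <= m * eps], that is, [m] at least [r / eps]. *)
  move=> t [u [ru Fu]]; exists u; split => //; apply: le_lt_trans ru.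
  rewrite -ler_pdivrMr//; near: m; exact: nbhs_infty_ger.
apply/fine_cvgP; split.
  near=> m; rewrite fin_num_measure// eventE; last by near: m; exact: nbhs_infty_gt.
  exact: measurable_zero_event.
apply/cvgrPdist_le => eta eta0; near=> m.
rewrite sub0r normrN ger0_norm ?fine_ge0 ?measure_ge0//.
rewrite -lee_fin fineK; first by near: m; exact: bound.
rewrite fin_num_measure// eventE; last by near: m; exact: nbhs_infty_gt.
exact: measurable_zero_event.
Unshelve. all: by end_near.
Qed.
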